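(* Let $G$ be a connected graph with $n$ vertices and $m$ edges, and let $N=\{i_1j_1,\ldots,i_kj_k\}$ be a dominating induced matching of $G$. Then $$S_L(G)\ \ge\ \frac{n(m-k)}{2k(n-2k)}-\delta .$$ If equality holds, then there are integers $s$ and $t$ such that $d_R(v)=s$ for all $v\in V(N)$ and $d_{V(N)}(v)=t$ for all $v\in R$, where $R=V(N)^c$; moreover, $s(2k)=(n-2k)t$, $\frac{n(m-k)}{2k(n-2k)}=\mu_1$ and $\delta=a(G)$.
   Context: Graphs are finite, simple and undirected. For a graph $G$ with $n$ vertices, $L(G)=D(G)-A(G)$ is the Laplacian matrix ($D(G)$ the diagonal matrix of vertex degrees, $A(G)$ the adjacency matrix), with eigenvalues $\mu_1\ge\dots\ge\mu_{n-1}\ge\mu_n=0$. The algebraic connectivity is $a(G)=\mu_{n-1}$ and the Laplacian spread is $S_L(G)=\mu_1-a(G)$. $\delta$ is the minimum degree of $G$. For $Y\subseteq V(G)$, $Y^c=V(G)\setminus Y$ and $d_Y(v)$ is the number of neighbors of $v$ in $Y$. A matching is a nonempty set of edges no two of which share a vertex. A matching $N$ is a dominating induced matching (DIM) if every edge of $G$ is either in $N$ or shares an end vertex with exactly one edge of $N$. Here $N$ consists of the $k$ edges $i_1j_1,\ldots,i_kj_k$, and $V(N)$ is the set of end vertices of the edges of $N$.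
   Formalization: The triangle K_3 is excluded, since the inequality fails there (S_L = 0 but the bound is 1); for K_2, where n = 2k and the bound reads 0/0, the quotient is taken to be 0. *)

(* Defs.v *)
From HB Require Import structures.
From mathcomp Require Import all_boot all_order all_algebra.
From mathcomp Require Import polyrcf.

Set Implicit Arguments.
Unset Strict Implicit.
Unset Printing Implicit Defensive.

Import Order.TTheory GRing.Theory Num.Theory.
Local Open Scope ring_scope.

(* A finite simple graph is a symmetric irreflexive relation e on a finType;
   symmetry and irreflexivity are hypotheses of the theorem. *)
Section Graph.

Variables (T : finType) (e : rel T).

Definition connected_graph : Prop := forall x y : T, connect e x y.

Definition complete_graph : Prop := forall x y : T, x != y -> e x y.

Definition edges : {set {set T}} :=
  [set f | [exists x, exists y, e x y && (f == [set x; y])]].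

Definition nbrs_in (Y : {set T}) (v : T) : nat := #|[set u in Y | e v u]|.

Definition degree (v : T) : nat := #|[set u | e v u]|.

(* Every degree is smaller than #|T|, so the default value #|T| of the
   iterated minimum plays no role when T is nonempty. *)
Definition min_degree : nat := \big[minn/#|T|]_(v : T) degree v.

Definition matching (N : {set {set T}}) : Prop :=
  [/\ N != set0, N \subset edges &
      forall f g, f \in N -> g \in N -> f != g -> [disjoint f & g]].

Definition dominating_induced_matching (N : {set {set T}}) : Prop :=
  matching N /\
  forall f, f \in edges ->
    f \in N \/ #|[set g in N | ~~ [disjoint f & g]]| = 1%N.

End Graph.

(* The eigenvalues in R of A, repeated according to their multiplicity as roots
   of the characteristic polynomial, in decreasing order.  A symmetric matrix
   of size n has n of them. *)
Definition eigenvalues (R : rcfType) (n : nat) (A : 'M[R]_n) : seq R :=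
  sort (fun a b : R => b <= a)
    (flatten [seq nseq (mup a (char_poly A)) a
             | a <- rootsR (char_poly A)]).

Section Laplacian.

(* R cannot be inferred from the graph, hence it is always explicit. *)
Variables (R : rcfType) (T : finType) (e : rel T).

Definition degree_mx : 'M[R]_#|T| :=
  diag_mx (\row_i (degree e (enum_val i))%:R).

Definition adjacency_mx : 'M[R]_#|T| :=
  \matrix_(i, j) (e (enum_val i) (enum_val j))%:R.

Definition laplacian : 'M[R]_#|T| := degree_mx - adjacency_mx.

(* mu_i, numbered from 1 to n *)
Definition lap_eigenvalue (i : nat) : R := (eigenvalues laplacian)`_i.-1.

Definition algebraic_connectivity : R := lap_eigenvalue #|T|.-1.

Definition laplacian_spread : R := lap_eigenvalue 1 - algebraic_connectivity.

End Laplacian.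

Arguments degree_mx R {T} e.
Arguments adjacency_mx R {T} e.
Arguments laplacian R {T} e.
Arguments lap_eigenvalue R {T} e i.
Arguments algebraic_connectivity R {T} e.
Arguments laplacian_spread R {T} e.

(* Main.v *)
Require Import Defs.
From HB Require Import structures.
From mathcomp Require Import all_boot all_order all_algebra.
From mathcomp Require Import polyrcf complex.
From mathcomp Require Import zify ring lra.

(** The graph splits along the matching.  Two matched vertices are adjacent
    only if their edge lies in N, and two unmatched vertices are never adjacent
    (lemmas [matched_edge] and [unmatched_independent]), so the m - k edges
    outside N are exactly the edges of the cut between V(N), of size 2k, and its
    complement R, of size n - 2k ([cut_matching]).

    Give the vertices of V(N) the value n - 2k and those of R the value - 2k.
    The Rayleigh quotient of the Laplacian at this vector is
    n(m - k) / (2k(n - 2k)), which is therefore at most mu_1 ([cut_le]).  On the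
    other hand, a graph that is not complete satisfies a(G) <= delta
    ([algebraic_connectivity_le_min_degree]), and K_2 and K_3 are the only
    complete graphs with a dominating induced matching.  Subtracting the two
    inequalities gives the bound on the spread.

    If the bound is attained, both inequalities are equalities.  A vector whose
    Rayleigh quotient is the largest eigenvalue is an eigenvector; at a vertex v
    of V(N) the eigenvector equation reads n d_R(v) = mu_1 (n - 2k), and at a
    vertex of R it reads n d_V(N)(v) = mu_1 2k ([cut_eq]).  Hence both degrees
    are constant, and counting the cut from either side relates them.

    When n = 2k the quotient in the bound is a division by zero, with value 0.
    Every vertex is then matched, so delta > 0 and the bound is strict.

    The facts about eigenvalues come from diagonalizing a real symmetric matrix
    by a unitary matrix over R[i]: in the coordinates [coords] the quadratic
    form becomes a sum of eigenvalues weighted by squared norms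
    ([coords_rayleigh]). *)

Set Implicit Arguments.
Unset Strict Implicit.
Unset Printing Implicit Defensive.

Import Order.TTheory GRing.Theory Num.Theory.
Local Open Scope ring_scope.

(** * Eigenvalues of real symmetric matrices *)

Lemma eigenvalues_prod (R : rcfType) (n : nat) (A : 'M[R]_n) (s : seq R) :
  char_poly A = \prod_(a <- s) ('X - a%:P) -> perm_eq (eigenvalues A) s.
Proof.
move=> chA; rewrite /eigenvalues perm_sort chA.
set p := \prod_(a <- s) _.
have p0 : p != 0 by rewrite monic_neq0 ?monic_prod_XsubC.
have in_roots b : (b \in rootsR p) = (b \in s).
  by rewrite -(roots_on_rootsR p0) inE /= /p root_prod_XsubC.
apply/allP => b _ /=; apply/eqP.
rewrite count_flatten -map_comp sumnE big_map.
under eq_bigr => a _ do rewrite /= count_nseq /= /p mu_prod_XsubC.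
rewrite -/p; have [bs|bs] := boolP (b \in rootsR p).
  rewrite (bigD1_seq b) ?uniq_roots //= eqxx mul1n big1 ?addn0 // => a /negPf ab.
  by rewrite ab.
rewrite big1_seq => [|a /andP[_ ar]].
  by apply/esym/count_memPn; rewrite -in_roots.
by case: eqP => // ab; rewrite -ab ar in bs.
Qed.

Lemma sorted_eigenvalues (R : rcfType) (n : nat) (A : 'M[R]_n) :
  sorted (fun a b : R => b <= a) (eigenvalues A).
Proof. by apply: sort_sorted => a b; apply: le_total. Qed.

Lemma eigenvalues_nth_le (R : rcfType) (n : nat) (A : 'M[R]_n) (i j : nat) :
  (i <= j)%N -> (j < size (eigenvalues A))%N ->
  (eigenvalues A)`_j <= (eigenvalues A)`_i.
Proof.
move=> ij js.
apply: (sorted_leq_nth _ _ 0 (sorted_eigenvalues A)) => //=.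
  by move=> a b c ab /le_trans; apply.
by rewrite inE (leq_ltn_trans ij).
Qed.

Section RealSpectral.

Local Open Scope sesquilinear_scope.

Variables (R : rcfType) (n : nat) (A : 'M[R]_n).
Hypothesis A_sym : A^T = A.

Local Notation "M ^%C" := (map_mx (real_complex R) M)
  (at level 2, format "M ^%C").
Local Notation P := (spectralmx A^%C).

Definition spectrum : 'rV[R]_n := map_mx (@complex.Re R) (spectral_diag A^%C).
Local Notation d := spectrum.

(** The coordinates of a real vector in an orthonormal eigenbasis of A; they are
    complex because the eigenbasis is only known to be unitary. *)
Definition coords (x : 'rV[R]_n) : 'rV[R[i]]_n := x^%C *m P^t*.

Let A_herm : A^%C \is hermsymmx.
Proof.
apply: realsym_hermsym.
  by apply/is_hermitianmxP; rewrite expr0 scale1r map_mx_id // map_trmx A_sym.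
by apply/mxOverP => i j; rewrite mxE complex_real.
Qed.

Let spectrumE : spectral_diag A^%C = d^%C.
Proof.
apply/rowP => i; rewrite !mxE; apply/esym/RRe_real.
by have /mxOverP/(_ 0 i) := hermitian_spectral_diag_real A_herm.
Qed.

Let spectral_decomposition : A^%C = P^t* *m diag_mx d^%C *m P.
Proof.
have /orthomx_spectralP := hermitian_normalmx A_herm.
by rewrite spectrumE invmx_unitary ?spectral_unitarymx.
Qed.

Let trCC (m k : nat) (x : 'M[R]_(m, k)) : x^%C^t* = x^T^%C.
Proof. by apply/matrixP => i j; rewrite !mxE; apply/CrealP; rewrite complex_real. Qed.

Let PK : P *m P^t* = 1%:M.
Proof. by apply/unitarymxP; apply: spectral_unitarymx. Qed.
Let PtK : P^t* *m P = 1%:M.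
Proof. by rewrite -(mulmx1C PK). Qed.

(** Conjugating A by the unitary matrix P does not change the characteristic
    polynomial, and a diagonal matrix shows its roots. *)
Lemma perm_eq_spectrum : perm_eq (eigenvalues A) [seq d 0 i | i : 'I_n].
Proof.
apply: eigenvalues_prod; rewrite big_image /=.
apply: (map_inj_poly (@complexI R)) => //.
rewrite map_char_poly rmorph_prod /=.
under eq_bigr => i _ do rewrite map_polyXsubC.
transitivity (char_poly (diag_mx d^%C)); last first.
  rewrite char_poly_trig; last exact/is_diag_mx_is_trig/diag_mx_is_diag.
  by apply: eq_bigr => i _; rewrite !mxE eqxx.
rewrite [in LHS]spectral_decomposition /char_poly /char_poly_mx.
have -> : 'X%:M - map_mx polyC (P^t* *m diag_mx d^%C *m P) =
   map_mx polyC (P^t*) *m ('X%:M - map_mx polyC (diag_mx d^%C)) *m map_mx polyC P.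
  rewrite mulmxBr mulmxBl -!map_mxM; congr (_ - _).
  by rewrite mul_mx_scalar -scalemxAl -map_mxM PtK map_mx1 scalemx1.
by rewrite !det_mulmx mulrC mulrA -det_mulmx -map_mxM PK map_mx1 det1 mul1r.
Qed.

Lemma size_eigenvalues : size (eigenvalues A) = n.
Proof. by rewrite (perm_size perm_eq_spectrum) size_image card_ord. Qed.

Lemma coords_inj : injective coords.
Proof.
move=> x y /(congr1 (mulmx^~ P)); rewrite /coords -!mulmxA PtK !mulmx1.
by move=> xy; apply/rowP => i; have /rowP/(_ i) := xy; rewrite !mxE => /complexI.
Qed.

Lemma coords0 : coords 0 = 0.
Proof. by rewrite /coords map_mx0 mul0mx. Qed.

Lemma coords_mulmx x i : coords (x *m A) 0 i = (d 0 i)%:C%C * coords x 0 i.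
Proof.
rewrite /coords map_mxM {1}spectral_decomposition -!mulmxA PK mulmx1 !mulmxA.
by rewrite mul_mx_diag !mxE mulrC.
Qed.

Lemma coordsZ a x i : coords (a *: x) 0 i = a%:C%C * coords x 0 i.
Proof. by rewrite /coords map_mxZ -scalemxAl mxE. Qed.

Lemma coords_dot x y :
  ((x *m y^T) 0 0)%:C%C = \sum_i coords x 0 i * (coords y 0 i)^*.
Proof.
have -> : ((x *m y^T) 0 0)%:C%C = (coords x *m (coords y)^t* ) 0 0.
  rewrite /coords trmx_mul map_mxM trmxCK -mulmxA (mulmxA _ P) PtK mul1mx.
  by rewrite trCC -map_mxM [RHS]mxE.
by rewrite mxE; apply: eq_bigr => i _; rewrite !mxE.
Qed.

Lemma coords_norm x : ((x *m x^T) 0 0)%:C%C = \sum_i `|coords x 0 i| ^+ 2.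
Proof. by rewrite coords_dot; apply: eq_bigr => i _; rewrite normCK. Qed.

(** Since A multiplies the i-th coordinate by the i-th eigenvalue and the
    coordinates preserve inner products, the form b - A is diagonal in them.
    The bounds below only read off the signs of its coefficients. *)
Lemma coords_rayleigh b x :
  (b * (x *m x^T) 0 0 - (x *m A *m x^T) 0 0)%:C%C =
  \sum_i (b - d 0 i)%:C%C * `|coords x 0 i| ^+ 2.
Proof.
rewrite rmorphB rmorphM /= coords_norm coords_dot mulr_sumr -sumrB.
by apply: eq_bigr => i _; rewrite coords_mulmx rmorphB normCK mulrBl !mulrA.
Qed.

Lemma spectrum_le_max i : d 0 i <= (eigenvalues A)`_0.
Proof.
have : d 0 i \in eigenvalues A by rewrite (perm_mem perm_eq_spectrum) image_f.
by case/(nthP 0) => j js <-; apply: eigenvalues_nth_le.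
Qed.

Lemma rayleigh_le_max (x : 'rV[R]_n) :
  (x *m A *m x^T) 0 0 <= (eigenvalues A)`_0 * (x *m x^T) 0 0.
Proof.
rewrite -subr_ge0 -ler0c coords_rayleigh sumr_ge0 // => i _.
by rewrite mulr_ge0 ?exprn_ge0 // ler0c subr_ge0 spectrum_le_max.
Qed.

(** The form (largest eigenvalue) - A is a sum of nonnegative terms.  If it
    vanishes at x, each coordinate of x is zero or belongs to the largest
    eigenvalue. *)
Lemma rayleigh_eq_max (x : 'rV[R]_n) :
  (x *m A *m x^T) 0 0 = (eigenvalues A)`_0 * (x *m x^T) 0 0 ->
  x *m A = (eigenvalues A)`_0 *: x.
Proof.
move=> /esym/eqP; rewrite -subr_eq0 => /eqP xmax.
have /eqP := coords_rayleigh (eigenvalues A)`_0 x.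
rewrite xmax eq_sym psumr_eq0 => [/allP zero|i _]; last first.
  by rewrite mulr_ge0 ?exprn_ge0 // ler0c subr_ge0 spectrum_le_max.
apply: coords_inj; apply/rowP => i; rewrite coords_mulmx coordsZ.
have /eqP := zero i (mem_index_enum i).
move=> /eqP; rewrite /= mulf_eq0 sqrf_eq0 normr_eq0 => /orP[|/eqP->].
  by rewrite rmorphB subr_eq0 => /eqP->.
by rewrite !mulr0.
Qed.

(** The case of the Courant-Fischer principle in which one of two orthogonal
    test vectors is an eigenvector.  If the second smallest eigenvalue were
    larger than b, a single eigenvalue would be at most b; the eigenvector u
    would live on that coordinate alone, y would have to vanish there, and the
    Rayleigh quotient of y would exceed b. *)
Lemma second_smallest_le (u y : 'rV[R]_n) (a b : R) :
  u *m A = a *: u -> u != 0 -> a <= b ->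
  y != 0 -> y *m u^T = 0 -> (y *m A *m y^T) 0 0 <= b * (y *m y^T) 0 0 ->
  (eigenvalues A)`_n.-2 <= b.
Proof.
move=> uA u0 ab y0 yu ray; rewrite leNgt; apply/negP => lt_b.
pose small := [pred i : 'I_n | d 0 i <= b].
(* Only the last entry of the decreasing list can be at most b. *)
have few : (#|small| <= 1)%N.
  have -> : #|small| = count (fun a => a <= b) (eigenvalues A).
    by rewrite (permP perm_eq_spectrum) count_map cardE /enum_mem size_filter
               count_filter; apply: eq_count => i /=; rewrite andbT.
  rewrite -(cat_take_drop n.-1 (eigenvalues A)) count_cat.
  have -> : count (fun a => a <= b) (take n.-1 (eigenvalues A)) = 0%N.
    apply/eqP; rewrite -leqn0 leqNgt -has_count; apply/hasPn => c.
    move=> /(nthP 0)[j]; rewrite size_takel ?size_eigenvalues ?leq_pred // => jn <-.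
    rewrite nth_take // -ltNge; apply: lt_le_trans lt_b _.
    apply: eigenvalues_nth_le; first by case: (n) jn => [|[]].
    by rewrite size_eigenvalues; case: (n) jn => [|[]].
  rewrite add0n (leq_trans (count_size _ _)) // size_drop size_eigenvalues.
  by case: (n) => // m; rewrite subSnn.
have u_supp i : coords u 0 i != 0 -> d 0 i <= b.
  move=> ui; have /rowP/(_ i) := congr1 coords uA.
  rewrite coords_mulmx coordsZ => /(mulIf ui)/complexI ->.
  by [].
have [i ui] : exists i, coords u 0 i != 0.
  apply/existsP; apply: contraNT u0 => /existsPn u_eq0.
  apply/eqP/coords_inj/rowP => i; move: (u_eq0 i); rewrite negbK => /eqP->.
  by rewrite coords0 mxE.
have only j : d 0 j <= b -> j = i.
  by move=> dj; apply: (card_le1_eqP few); rewrite !inE ?(u_supp i ui).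
have yi : coords y 0 i = 0.
  have := coords_dot y u; rewrite yu mxE (bigD1 i) //= big1 ?addr0.
    move=> /esym/eqP; rewrite mulf_eq0 conjC_eq0 (negPf ui) orbF.
    by move=> /eqP.
  move=> j ji; have -> : coords u 0 j = 0; last by rewrite conjC0 mulr0.
  by apply/eqP; apply: contraNT ji => /u_supp/only->.
have le0 j : (b - d 0 j)%:C%C * `|coords y 0 j| ^+ 2 <= 0.
  have [->|ji] := eqVneq j i; first by rewrite yi normr0 expr0n mulr0.
  rewrite mulr_le0_ge0 ?exprn_ge0 // -(rmorph0 (real_complex R)) lecR subr_le0 ltW //.
  by rewrite ltNge; apply: contraNN ji => /only->.
have : \sum_j - ((b - d 0 j)%:C%C * `|coords y 0 j| ^+ 2) == 0.
  rewrite eq_le sumr_ge0 ?andbT => [|j _]; last by rewrite oppr_ge0.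
  by rewrite sumrN -coords_rayleigh oppr_le0 ler0c subr_ge0.
rewrite psumr_eq0 => [/allP zero|j _]; last by rewrite oppr_ge0.
move/eqP: y0; apply; apply: coords_inj; apply/rowP => j.
rewrite coords0 [RHS]mxE.
have [->//|ji] := eqVneq j i.
have := zero j (mem_index_enum j); rewrite /= oppr_eq0 mulf_eq0 sqrf_eq0 normr_eq0.
case/orP => [|/eqP//]; rewrite fmorph_eq0 subr_eq0 => /eqP bd; move/eqP: ji; case; apply: only.
by rewrite bd.
Qed.

End RealSpectral.

(** * Quadratic form of the Laplacian *)

Section LaplacianForms.

Variables (R : rcfType) (T : finType) (e : rel T).
Hypotheses (e_sym : symmetric e) (e_irr : irreflexive e).

Local Notation L := (laplacian R e).
Local Notation n := #|T|.
Local Notation mu1 := (lap_eigenvalue R e 1).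

Definition vertex_row (f : T -> R) : 'rV[R]_#|T| := \row_i f (enum_val i).

Lemma sum_enum_val (F : T -> R) : \sum_(i < n) F (enum_val i) = \sum_v F v.
Proof. by rewrite -(big_enum_val F). Qed.

Lemma vertex_row_inj f g : vertex_row f = vertex_row g -> f =1 g.
Proof. by move=> fg v; have /rowP/(_ (enum_rank v)) := fg; rewrite !mxE enum_rankK. Qed.

Lemma vertex_row_dot f g :
  (vertex_row f *m (vertex_row g)^T) 0 0 = \sum_v f v * g v.
Proof.
by rewrite mxE -sum_enum_val; apply: eq_bigr => i _; rewrite !mxE.
Qed.

Lemma laplacian_sym : L^T = L.
Proof.
apply/matrixP => i j; rewrite !mxE e_sym eq_sym.
by case: eqVneq => [->|_]; rewrite ?mulr0n.
Qed.

Lemma degree_sum v : (degree e v)%:R = \sum_u (e v u)%:R :> R.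
Proof.
rewrite /degree -sum1_card natr_sum big_mkcond /=.
by apply: eq_bigr => u _; rewrite inE; case: e.
Qed.

Lemma nbrs_in_sum Y v : nbrs_in e Y v = (\sum_(u in Y) e v u)%N.
Proof.
rewrite /nbrs_in -sum1_card big_mkcond [RHS]big_mkcond /=.
by apply: eq_bigr => u _; rewrite !inE; case: (u \in Y); case: e.
Qed.

Lemma vertex_row_laplacian f :
  vertex_row f *m L = vertex_row (fun v => \sum_u (e v u)%:R * (f v - f u)).
Proof.
rewrite mulmxBr mul_mx_diag; apply/rowP => j; rewrite !mxE.
rewrite degree_sum mulr_sumr.
under [X in _ - X]eq_bigr => i _ do rewrite !mxE e_sym.
rewrite (sum_enum_val (fun u => f u * (e (enum_val j) u)%:R)) -sumrB.
by apply: eq_bigr => u _; rewrite mulrBr mulrC (mulrC (f u)).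
Qed.

(** The test vector takes the value |W| at v and -1 on the nonempty set W of the
    other vertices that are not adjacent to v, so it is orthogonal to the constants.
    The bound h L h <= deg(v) h h even holds term by term: at v the Laplacian
    gives deg(v) |W|, and at a vertex of W it gives minus the number of common
    neighbours with v, which is at least - deg(v). *)
Lemma algebraic_connectivity_le_degree v w : v != w -> ~~ e v w ->
  algebraic_connectivity R e <= (degree e v)%:R.
Proof.
move=> vw evw.
pose W := [set u | (u != v) && ~~ e v u].
have W_gt0 : (0 : R) < #|W|%:R.
  by rewrite ltr0n; apply/card_gt0P; exists w; rewrite inE eq_sym vw.
pose h u : R := if u == v then #|W|%:R else - (u \in W)%:R.
have hv : h v = #|W|%:R by rewrite /h eqxx.
have h_nbr u : e v u -> h u = 0.
  move=> vu; rewrite /h inE vu andbF oppr0.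
  by case: eqP vu => // ->; rewrite e_irr.
have hW u : u \in W -> h u = -1.
  by rewrite /h => uW; rewrite uW; move: uW; rewrite inE => /andP[/negPf->].
apply: (second_smallest_le laplacian_sym
          (u := vertex_row (fun=> 1)) (y := vertex_row h) (a := 0)).
- rewrite vertex_row_laplacian scale0r; apply/rowP => i; rewrite !mxE.
  by rewrite big1 // => u _; rewrite subrr mulr0.
- apply/eqP => /rowP/(_ (enum_rank v))/eqP.
  by rewrite !mxE oner_eq0.
- exact: ler0n.
- apply/eqP => /rowP/(_ (enum_rank v))/eqP.
  by rewrite !mxE enum_rankK hv gt_eqF.
- apply/matrixP => i j; rewrite !ord1 vertex_row_dot [RHS]mxE.
  under eq_bigr do rewrite mulr1.
  rewrite (bigD1 v) //= hv (eq_bigr (fun u => - (u \in W)%:R)) => [|u /negPf uv].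
    apply/eqP; rewrite sumrN subr_eq0 -sum1_card natr_sum; apply/eqP.
    rewrite big_mkcond [RHS]big_mkcond; apply: eq_bigr => u _.
    by rewrite inE; case: (u != v); case: (e v u).
  by rewrite /h uv.
rewrite vertex_row_laplacian !vertex_row_dot mulr_sumr.
apply: ler_sum => u _.
have [->|uv] := eqVneq u v.
  rewrite hv mulrA ler_pM2r // degree_sum mulr_suml.
  apply: ler_sum => x _; case: (boolP (e v x)) => [/h_nbr->|_].
    by rewrite subr0.
  by rewrite !mul0r.
have [uW|uW] := boolP (u \in W); last first.
  by rewrite /h (negPf uv) (negPf uW) oppr0 !mulr0.
rewrite hW // mulrNN mulr1 mulrN1 -sumrN degree_sum mulr1; apply: ler_sum => x _.
have [vx|vx] := boolP (e v x).
  by rewrite h_nbr // subr0 mulrN1 opprK; case: (e u x).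
have [->|xv] := eqVneq x v.
  by move: uW; rewrite inE e_sym => /andP[_ /negPf->]; rewrite mul0r oppr0.
by rewrite hW ?subrr ?mulr0 ?oppr0 // inE xv.
Qed.

Definition cut (A : {set T}) : nat := \sum_(v in A) nbrs_in e (~: A) v.

Lemma cutC A : cut (~: A) = cut A.
Proof.
rewrite /cut setCK.
under eq_bigr do rewrite nbrs_in_sum.
under [RHS]eq_bigr do rewrite nbrs_in_sum.
rewrite exchange_big /=; apply: eq_bigr => v _.
by apply: eq_bigr => u _; rewrite e_sym.
Qed.

(** The indicator function of A, projected orthogonally to the constants and
    scaled by n to clear denominators. *)
Definition cut_fun (A : {set T}) (v : T) : R :=
  if v \in A then #|~: A|%:R else - #|A|%:R.

Lemma cut_fun_laplacian A :
  vertex_row (cut_fun A) *m L = vertex_row (fun v =>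
    if v \in A then n%:R * (nbrs_in e (~: A) v)%:R
    else - (n%:R * (nbrs_in e A v)%:R)).
Proof.
rewrite vertex_row_laplacian; apply/rowP => i; rewrite !mxE.
have nE : n%:R = #|A|%:R + #|~: A|%:R :> R by rewrite -natrD cardsC.
move: (enum_val i) => v; rewrite /cut_fun nE; case: ifP => vA.
  rewrite nbrs_in_sum natr_sum mulr_sumr [RHS]big_mkcond /=.
  by apply: eq_bigr => u _; rewrite inE; case: ifP => _ /=; ring.
rewrite nbrs_in_sum natr_sum mulr_sumr -sumrN [RHS]big_mkcond /=.
by apply: eq_bigr => u _; case: ifP => _ /=; ring.
Qed.

Lemma cut_fun_rayleigh A :
  (vertex_row (cut_fun A) *m L *m (vertex_row (cut_fun A))^T) 0 0 =
  n%:R * (n%:R * (cut A)%:R).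
Proof.
have nE : n%:R = #|A|%:R + #|~: A|%:R :> R by rewrite -natrD cardsC.
rewrite cut_fun_laplacian vertex_row_dot (bigID (mem A)) /=.
rewrite [RHS](_ : _ = #|A|%:R * (n%:R * (cut A)%:R)
                      + #|~: A|%:R * (n%:R * (cut A)%:R)); last first.
  by rewrite -mulrDl -nE.
rewrite addrC; congr (_ + _).
  rewrite -{1}cutC /cut setCK natr_sum !mulr_sumr.
  apply: eq_big => [v|v vA]; first by rewrite inE.
  by rewrite /cut_fun (negPf vA); ring.
rewrite /cut natr_sum !mulr_sumr; apply: eq_bigr => v vA.
by rewrite /cut_fun vA; ring.
Qed.

Lemma cut_fun_norm A :
  (vertex_row (cut_fun A) *m (vertex_row (cut_fun A))^T) 0 0 =
  n%:R * (#|A|%:R * #|~: A|%:R).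
Proof.
have nE : n%:R = #|A|%:R + #|~: A|%:R :> R by rewrite -natrD cardsC.
rewrite vertex_row_dot (bigID (mem A)) /=.
rewrite (eq_bigr (fun=> #|~: A|%:R * #|~: A|%:R)) => [|v vA]; last first.
  by rewrite /cut_fun vA.
rewrite [X in _ + X](eq_bigr (fun=> #|A|%:R * #|A|%:R)) => [|v /negPf vA]; last first.
  by rewrite /cut_fun vA mulrNN.
rewrite !sumr_const nE.
have -> : #|[pred v | v \notin A]| = #|~: A| by apply: eq_card => v; rewrite !inE.
by rewrite -[X in X + _]mulr_natr -[X in _ + X]mulr_natr; ring.
Qed.

(** The comparison of the Rayleigh quotient of [cut_fun A], which is
    n cut(A) / (|A| |A^c|), with the largest eigenvalue. *)
Lemma cut_le A : n%:R * (cut A)%:R <= mu1 * (#|A|%:R * #|~: A|%:R).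
Proof.
have [n0|n_gt0] := posnP n.
  have -> : #|A| = 0%N by apply/eqP; rewrite -leqn0 -n0 max_card.
  by rewrite n0 !mul0r mulr0.
have := rayleigh_le_max laplacian_sym (vertex_row (cut_fun A)).
by rewrite cut_fun_rayleigh cut_fun_norm [leRHS]mulrCA ler_pM2l ?ltr0n.
Qed.

(** In the equality case [cut_fun A] is an eigenvector for the largest
    eigenvalue, and the eigenvector equation at each vertex computes its number
    of neighbours across the cut. *)
Lemma cut_eq A : n%:R * (cut A)%:R = mu1 * (#|A|%:R * #|~: A|%:R) ->
  (forall v, v \in A -> n%:R * (nbrs_in e (~: A) v)%:R = mu1 * #|~: A|%:R) /\
  (forall v, v \in ~: A -> n%:R * (nbrs_in e A v)%:R = mu1 * #|A|%:R).
Proof.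
move=> cutA.
have := rayleigh_eq_max laplacian_sym (x := vertex_row (cut_fun A)).
rewrite cut_fun_rayleigh cut_fun_norm cutA mulrCA => /(_ erefl).
rewrite cut_fun_laplacian => eig.
have {}eig : vertex_row (fun v => if v \in A then n%:R * (nbrs_in e (~: A) v)%:R
    else - (n%:R * (nbrs_in e A v)%:R)) = vertex_row (fun v => mu1 * cut_fun A v).
  by rewrite eig; apply/rowP => i; rewrite !mxE.
split=> v vA; have := vertex_row_inj eig v; rewrite /cut_fun.
  by rewrite vA.
by move: vA; rewrite inE => /negPf-> /eqP; rewrite mulrN eqr_opp => /eqP.
Qed.

Lemma min_degree_le v : (min_degree e <= degree e v)%N.
Proof.
rewrite /min_degree; have := mem_index_enum v.
elim: (index_enum T) => // w s IHs; rewrite inE big_cons geq_min.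
by case/orP => [/eqP->|/IHs->]; rewrite ?leqnn ?orbT.
Qed.

Lemma min_degree_attained : T -> exists v, degree e v = min_degree e.
Proof.
move=> v0; have [v _ v_min] := arg_minnP (degree e) (erefl (xpredT v0)).
exists v; apply/eqP; rewrite eqn_leq min_degree_le andbT.
rewrite /min_degree; elim/big_ind: _ => [|a b ? ?|w _]; first exact: max_card.
  by rewrite leq_min; apply/andP.
exact: v_min.
Qed.

(** A missing edge forces the minimum degree to be at most n - 2, so a vertex
    that attains it has a non-neighbour too. *)
Lemma algebraic_connectivity_le_min_degree x y : x != y -> ~~ e x y ->
  algebraic_connectivity R e <= (min_degree e)%:R.
Proof.
move=> xy exy; have [v deg_v] := min_degree_attained x.
have /existsP[w /andP[vw evw]] : [exists w, (v != w) && ~~ e v w].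
  apply/contraT => /existsPn full.
  have := min_degree_le x; rewrite -deg_v leqNgt => /negP[].
  have -> : degree e v = #|[set~ v]|.
    apply: eq_card => w; rewrite !inE; have := full w.
    by rewrite negb_and !negbK eq_sym; case: eqVneq => [->|_ /=]; rewrite ?e_irr.
  rewrite cardsC1; apply: leq_ltn_trans (_ : #|[set~ x] :\ y| < _)%N.
    apply: subset_leq_card; apply/subsetP => w; rewrite !inE => xw.
    by apply/andP; split; apply: contraTneq xw => ->; rewrite ?e_irr.
  by rewrite -(cardsC1 x) [X in (_ < X)%N](cardsD1 y) !inE eq_sym xy.
by rewrite -deg_v; apply: algebraic_connectivity_le_degree vw evw.
Qed.

Lemma laplacian_spread_ge0 : (1 < n)%N -> 0 <= laplacian_spread R e.
Proof.
move=> n_gt1; rewrite subr_ge0; apply: eigenvalues_nth_le => //.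
by rewrite size_eigenvalues ?laplacian_sym //; case: (n) n_gt1 => [|[]].
Qed.

End LaplacianForms.

(** * Dominating induced matchings *)

Section DominatingInducedMatching.

Variables (T : finType) (e : rel T) (N : {set {set T}}).
Hypotheses (e_sym : symmetric e) (e_irr : irreflexive e).
Hypothesis N_dim : dominating_induced_matching e N.

Lemma edgesP (f : {set T}) :
  reflect (exists x y, e x y /\ f = [set x; y]) (f \in edges e).
Proof.
rewrite inE; apply: (iffP existsP) => [[x /existsP[y /andP[xy /eqP->]]]|].
  by exists x, y.
by case=> x [y [xy ->]]; exists x; apply/existsP; exists y; rewrite xy eqxx.
Qed.

Lemma card_edge f : f \in edges e -> #|f| = 2%N.
Proof.
case/edgesP => x [y [xy ->]]; rewrite cards2.
by case: eqP xy => // ->; rewrite e_irr.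
Qed.

Lemma matching_eq f g x : f \in N -> g \in N -> x \in f -> x \in g -> f = g.
Proof.
case: N_dim => -[_ _ N_disj] _ fN gN xf xg; apply/eqP/negPn/negP => fg.
by have /disjointFr/(_ xf) := N_disj _ _ fN gN fg; rewrite xg.
Qed.

Lemma card_matching_cover : #|cover N| = (2 * #|N|)%N.
Proof.
case: N_dim => -[_ /subsetP N_edges N_disj] _.
rewrite -(eqP (_ : trivIset N)); last by apply/trivIsetP => f g; apply: N_disj.
rewrite (eq_bigr (fun=> 2%N)) => [|f /N_edges/card_edge //].
by rewrite sum_nat_const mulnC.
Qed.

(** An edge outside N meets exactly one edge h of N.  If both its ends are
    matched, they both belong to h, and the edge is h itself. *)
Lemma matched_edge x y : x \in cover N -> y \in cover N -> e x y ->
  [set x; y] \in N.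
Proof.
case/bigcupP => f fN xf /bigcupP[g gN yg] xy.
have xyE : [set x; y] \in edges e by apply/edgesP; exists x, y.
have [//|/eqP/cards1P[h hE]] := N_dim.2 _ xyE.
have meets k z : k \in N -> z \in [set x; y] -> z \in k -> k = h.
  move=> kN z1 z2; apply/set1P; rewrite -hE inE kN /=.
  by apply/negP => /disjointFr/(_ z1); rewrite z2.
have fh : f = h by apply: meets xf; rewrite ?set21.
have gh : g = h by apply: meets yg; rewrite ?set22.
suff -> : [set x; y] = f by [].
have [_ N_edges _] := N_dim.1.
apply/eqP; rewrite eqEcard (card_edge (f := f)) ?(subsetP N_edges) //.
rewrite (card_edge (f := [set x; y])) // andbT.
by rewrite subUset !sub1set xf fh -gh.
Qed.

Lemma unmatched_independent x y : x \notin cover N -> y \notin cover N -> ~~ e x y.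
Proof.
move=> xN yN; apply/negP => xy.
have notin g z : g \in N -> z \in [set x; y] -> z \notin g.
  move=> gN /set2P[]->; [apply: contraNN xN|apply: contraNN yN] => zg;
  by apply/bigcupP; exists g.
have xyE : [set x; y] \in edges e by apply/edgesP; exists x, y.
have [xyN|/eqP/cards1P[h hE]] := N_dim.2 _ xyE.
  by have := notin _ _ xyN (set21 x y); rewrite set21.
have : h \in [set h] by rewrite set11.
rewrite -hE inE => /andP[hN /negP]; apply.
apply/pred0P => z /=; apply/negP => /andP[zxy zh].
by have := notin _ _ hN zxy; rewrite zh.
Qed.

(** Each edge outside N has exactly one matched end; orienting it from that end
    puts these edges in bijection with the pairs counted by the cut. *)
Lemma cut_matching : cut e (cover N) = (#|edges e| - #|N|)%N.
Proof.
case: N_dim => -[_ N_edges _] _.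
have -> : (#|edges e| - #|N|)%N = #|edges e :\: N|.
  by rewrite cardsD (setIidPr N_edges).
pose D := [set p | (p.1 \in cover N) && (p.2 \in ~: cover N) && e p.1 p.2].
have -> : cut e (cover N) = #|D|.
  transitivity (\sum_(v in cover N) \sum_(u | (u \in ~: cover N) && e v u) 1)%N.
    apply: eq_bigr => v _; rewrite sum1_card; apply: eq_card => u.
    by rewrite [in RHS]unfold_in !inE.
  rewrite pair_big_dep sum1_card; apply: eq_card => p.
  by rewrite [in LHS]unfold_in !inE -andbA.
have -> : edges e :\: N = [set [set p.1; p.2] | p in D].
  apply/setP => f; apply/setDP/imsetP => [[/edgesP[x [y [xy ->]]] xyN]|].
    have [xN|xN] := boolP (x \in cover N).
      exists (x, y) => //; rewrite !inE /= xN xy andbT.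
      by apply: contraNN xyN => yN; apply: matched_edge.
    exists (y, x); last by rewrite setUC.
    rewrite !inE /= xN e_sym xy !andbT.
    by apply: contraTT xy => yN; apply: unmatched_independent.
  case=> -[x y] xyD ->; rewrite !inE /= in xyD.
  case/andP: xyD => /andP[xN yN] xy; split.
    by apply/edgesP; exists x, y.
  by apply: contraNN yN => xyN; apply/bigcupP; exists [set x; y]; rewrite ?set22.
rewrite card_in_imset // => -[x y] [x' y']; rewrite !inE /=.
move=> /andP[/andP[xN yN] _] /andP[/andP[xN' yN'] _] /setP xyE.
have /set2P[xx|xy] : x \in [set x'; y'] by rewrite -xyE set21.
  have /set2P[yx|->] : y \in [set x'; y'] by rewrite -xyE set22.
    by rewrite yx xN' in yN.
  by rewrite xx.
by rewrite -xy xN in yN'.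
Qed.

(** In a complete graph the unmatched vertices, being independent, number at
    most one, and an edge joining two edges of N would lie in N, so N has a
    single edge: with an unmatched vertex the graph is a triangle. *)
Lemma dim_not_complete : (2 * #|N| < #|T|)%N ->
  ~ (#|T| = 3%N /\ complete_graph e) ->
  exists x y, x != y /\ ~~ e x y.
Proof.
move=> R_gt0 not_K3.
have [/existsP[x /existsP[y /andP[]]]|/existsPn full] :=
  boolP [exists x, exists y, (x != y) && ~~ e x y].
  by exists x, y.
have e_full : complete_graph e.
  by move=> x y xy; have /existsPn/(_ y) := full x; rewrite xy negbK.
case: not_K3; split=> //.
have N_gt0 : (0 < #|N|)%N by case: N_dim => -[N0 _ _] _; rewrite card_gt0.
have R_le1 : (#|~: cover N| <= 1)%N.
  apply/card_le1_eqP => x y; rewrite !inE => xN yN.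
  apply/eqP/negPn/negP; rewrite eq_sym => /e_full.
  by apply/negP; apply: unmatched_independent.
have N_le1 : (#|N| <= 1)%N.
  apply/card_le1_eqP => f g fN gN; apply/esym.
  have [_ /subsetP N_edges _] := N_dim.1.
  have /edgesP[a [a1 [_ fE]]] := N_edges _ fN.
  have /edgesP[b [b1 [_ gE]]] := N_edges _ gN.
  have af : a \in f by rewrite fE set21.
  have bg : b \in g by rewrite gE set21.
  have [ab|ab] := eqVneq a b.
    by apply: (matching_eq fN gN af); rewrite ab.
  have abN : [set a; b] \in N.
    by apply: matched_edge (e_full _ _ ab); apply/bigcupP; [exists f|exists g].
  rewrite -(matching_eq (x := a) abN fN) ?set21 //.
  by rewrite -(matching_eq (x := b) abN gN) ?set22.
by have := cardsC (cover N); rewrite card_matching_cover; lia.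
Qed.

Lemma matched_degree_gt0 v : v \in cover N -> (0 < degree e v)%N.
Proof.
case: N_dim => -[_ /subsetP N_edges _] _ /bigcupP[f /N_edges].
case/edgesP => x [y [xy ->]] /set2P[]->; apply/card_gt0P.
  by exists y; rewrite inE.
by exists x; rewrite inE e_sym.
Qed.

End DominatingInducedMatching.

(** * The bound on the Laplacian spread *)

Unset Implicit Arguments.

Theorem corollary11 (R : rcfType) (T : finType) (e : rel T)
    (e_sym : symmetric e) (e_irr : irreflexive e)
    (e_conn : connected_graph e)
    (* the inequality fails for the complete graph on three vertices *)
    (not_K3 : ~ (#|T| = 3%N /\ complete_graph e))
    (N : {set {set T}}) (N_dim : dominating_induced_matching e N) :
  let n := #|T| in
  let m := #|edges e| in
  let k := #|N| in
  let VN : {set T} := cover N in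
  let RN : {set T} := ~: VN in
  let B : R := (n%:R * (m%:R - k%:R)) / (2 * k%:R * (n%:R - 2 * k%:R)) in
  laplacian_spread R e >= B - (min_degree e)%:R
  /\ (laplacian_spread R e = B - (min_degree e)%:R ->
      exists s t : int,
        [/\ forall v, v \in VN -> Posz (nbrs_in e RN v) = s,
            forall v, v \in RN -> Posz (nbrs_in e VN v) = t,
            s * (2 * Posz k) = (Posz n - 2 * Posz k) * t,
            B = lap_eigenvalue R e 1
          & (min_degree e)%:R = algebraic_connectivity R e]).
Proof.
move=> n m k VN RN B.
have card_VN : #|VN| = (2 * k)%N by apply: card_matching_cover.
have card_n : (#|VN| + #|RN|)%N = n by apply: cardsC.
have N_gt0 : (0 < k)%N by case: N_dim => -[N0 _ _] _; rewrite /k card_gt0.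
have k_le_m : (k <= m)%N.
  by case: N_dim => -[_ N_edges _] _; apply: subset_leq_card.
have BE : B = n%:R * (cut e VN)%:R / (#|VN|%:R * #|RN|%:R).
  rewrite (cut_matching e_sym e_irr N_dim) natrB // -/m -/k.
  by rewrite /B -card_n natrD -[2 * k%:R]natrM -card_VN addrAC subrr add0r.
have [x0 x0N] : exists v, v \in VN by apply/card_gt0P; rewrite card_VN; lia.
(* If all vertices are matched, the denominator of B is 0. *)
have [RN0|RN_gt0] := posnP #|RN|.
  have B0 : B = 0 by rewrite BE RN0 mulr0 invr0 mulr0.
  have min_gt0 : (0 : R) < (min_degree e)%:R.
    have [v <-] := min_degree_attained e x0.
    rewrite ltr0n; apply: (matched_degree_gt0 e_sym N_dim).
    by have /eqP := RN0; rewrite cards_eq0 => /eqP/setP/(_ v); rewrite !inE => /negPn.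
  have := laplacian_spread_ge0 R e_sym.
  rewrite -/n B0 sub0r => /(_ ltac:(lia)) S_ge0.
  split; first by apply: le_trans S_ge0; rewrite oppr_le0 ltW.
  by move=> S_eq; move: S_ge0; rewrite S_eq oppr_ge0 leNgt min_gt0.
have VNR_gt0 : (0 : R) < #|VN|%:R * #|RN|%:R.
  by rewrite mulr_gt0 ?ltr0n // card_VN; lia.
have B_le : B <= lap_eigenvalue R e 1.
  by rewrite BE ler_pdivrMr //; apply: cut_le.
have a_le : algebraic_connectivity R e <= (min_degree e)%:R.
  have [x [y [xy exy]]] := dim_not_complete e_irr N_dim ltac:(lia) not_K3.
  exact: (algebraic_connectivity_le_min_degree R e_sym e_irr xy exy).
split=> [|S_eq]; first by rewrite /laplacian_spread; lra.
have B_eq : B = lap_eigenvalue R e 1.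
  by move: S_eq; rewrite /laplacian_spread; lra.
have a_eq : (min_degree e)%:R = algebraic_connectivity R e.
  by move: S_eq; rewrite /laplacian_spread; lra.
have [] := cut_eq (R := R) e_sym (A := VN).
  by rewrite -B_eq BE mulfVK ?gt_eqF.
rewrite -/n -/RN => s_eq t_eq.
have [y0 y0N] : exists v, v \in RN by apply/card_gt0P.
have n_neq0 : n%:R != 0 :> R by rewrite pnatr_eq0; lia.
have s_const v : v \in VN -> nbrs_in e RN v = nbrs_in e RN x0.
  move=> vN; apply/eqP; rewrite -(eqr_nat R); apply/eqP.
  by apply: (mulfI n_neq0); rewrite !s_eq.
have t_const v : v \in RN -> nbrs_in e VN v = nbrs_in e VN y0.
  move=> vN; apply/eqP; rewrite -(eqr_nat R); apply/eqP.
  by apply: (mulfI n_neq0); rewrite !t_eq.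
exists (nbrs_in e RN x0), (nbrs_in e VN y0); split=> //.
- by move=> v /s_const->.
- by move=> v /t_const->.
have := cutC e_sym VN; rewrite /cut setCK -/RN.
rewrite (eq_bigr _ s_const) (eq_bigr _ t_const) !sum_nat_const.
by rewrite card_VN; have := card_n; rewrite card_VN; nia.
Qed.
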